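(* Let $\mathcal{P}$ be a phase space with coordinates $x$ and let $\mathcal{H}$ be the Hamiltonian constraint that generates the dynamical evolution of the system, i.e. the dynamics is given by $\frac{dx}{d\tau}=\lambda\{x,\mathcal{H}\}$ for an admissible function $\lambda$, with solution $x(\tau,x_0)$ for the initial condition $x(0,x_0)=x_0$. Let $\Gamma\subset\mathcal{P}$ be a phase-space trajectory generated by $\mathcal{H}$ such that the dynamics is injective during this trajectory, i.e. for $x_0\in\Gamma$, $x(\tau,x_0)=x(\tau',x_0)$ implies $\tau=\tau'$. Let $X_1,X_2\in\Gamma$ be two fixed points on the trajectory. Then one can define the temporal order function $\mathrm{TO}(X_1,X_2,x)$, evaluated at $x\in\Gamma$, such that $$\mathrm{TO}(X_1,X_2,x)=\begin{cases}1 & \text{if } X_1 \text{ happens after } X_2,\\ -1 & \text{if } X_1 \text{ happens before } X_2,\\ 0 & \text{if } X_1=X_2,\end{cases}$$ where ''before'' and ''after'' refer to the solution with initial condition $x$ and to the time orientation of the Hamiltonian flow: for each $i\in\{1,2\}$ and each $x\in\Gamma$ there is exactly one $\tau_i\in\mathbb{R}$ with $x(\tau_i,x)=X_i$, and $X_1$ happens after (respectively before) $X_2$ if $\tau_1>\tau_2$ (respectively $\tau_1<\tau_2$). Moreover, the function $x\mapsto\mathrm{TO}(X_1,X_2,x)$ is constant when $x$ varies along $\Gamma$.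
   Context: Setting (temporally diffeomorphism-invariant Hamiltonian systems). The phase space $\mathcal{P}$ is a smooth symplectic manifold with Poisson bracket $\{\cdot,\cdot\}$ (in canonical coordinates $\{f,g\}=\sum_a \frac{\partial f}{\partial q^a}\frac{\partial g}{\partial p_a}-\frac{\partial f}{\partial p_a}\frac{\partial g}{\partial q^a}$). The system has a single constraint, a smooth function $\mathcal{H}$ on $\mathcal{P}$ (the Hamiltonian constraint), and its Hamiltonian is $H_\lambda=\lambda(\tau,x)\mathcal{H}$, where $\lambda$ is an arbitrary function whose choice reflects the freedom of reparametrizing the time parameter $\tau$. The equations of motion are $\frac{dx}{d\tau}=\lambda\{x,\mathcal{H}\}$. The solution with initial condition $x_0$ at $\tau=0$ is $$x(\tau,x_0)=\Phi_{t_\lambda(\tau)}(x_0),\qquad t_\lambda(\tau)=\int_0^\tau\lambda(\tau',x(\tau',x_0))\,d\tau',$$ where $\Phi_t=\exp(t\{\cdot,\mathcal{H}\})$ is the flow of the Hamiltonian vector field of $\mathcal{H}$, i.e. $\frac{d}{dt}\Phi_t(x_0)=\{x,\mathcal{H}\}|_{x=\Phi_t(x_0)}$, $\Phi_0(x_0)=x_0$. The flow is assumed to be defined for all $t\in\mathbb{R}$. The function $\lambda$ is called admissible if it is smooth and positive and, for every $x_0$, $\tau\mapsto t_\lambda(\tau)$ is an increasing bijection of $\mathbb{R}$ (so that different admissible $\lambda$ give orientation-preserving reparametrizations of the same curve; $\lambda=1$ gives $t_\lambda(\tau)=\tau$). A phase-space trajectory generated by $\mathcal{H}$ is a set $\Gamma=\{x(\tau,x_0):\tau\in\mathbb{R}\}=\{\Phi_t(x_0):t\in\mathbb{R}\}$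 for some $x_0\in\mathcal{P}$. Injective temporal evolution: the temporal evolution of a system described by a trajectory $x(\tau)$ in phase space is injective if $x(\tau)=x(\tau')\implies\tau=\tau'$, i.e. the trajectory does not go through the same point more than once. (This property does not depend on which admissible $\lambda$ or which initial point of $\Gamma$ is used.) *)

(* Defs.v *)
From HB Require Import structures.
From mathcomp Require Import all_boot all_order all_algebra.
From mathcomp Require Import all_classical all_reals all_analysis.
Set Implicit Arguments.
Unset Strict Implicit.
Unset Printing Implicit Defensive.
Import Order.TTheory GRing.Theory Num.Theory.
Import numFieldNormedType.Exports.
Local Open Scope classical_set_scope.
Local Open Scope ring_scope.

Section Smoothness.
Context {R : realType} {m : nat}.
Implicit Types (U : set 'rV[R]_m) (f : 'rV[R]_m -> R).

Definition partial (i : 'I_m) f : 'rV[R]_m -> R := 'D_(delta_mx 0 i) f.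

(* f is C^k at the points of U; only meaningful for U open. *)
Fixpoint is_Ck (k : nat) U f : Prop :=
  (forall u, U u -> {for u, continuous f}) /\
  if k is k'.+1 then
    forall i, (forall u, U u -> derivable f u (delta_mx 0 i)) /\
              is_Ck k' U (partial i f)
  else True.

Definition smooth_on U f : Prop := forall k, is_Ck k U f.

End Smoothness.

(* coord is only relevant on dom, and param, its inverse, only on cod. *)
Record chart (R : realType) (P : topologicalType) (m : nat) := Chart {
  dom : set P ;
  coord :> P -> 'rV[R]_m ;
  param : 'rV[R]_m -> P }.

Section Charts.
Context {R : realType} {P : topologicalType} {m : nat}.
Implicit Types c : chart R P m.

Definition cod c : set 'rV[R]_m := c @` dom c.

Definition is_chart c : Prop :=
  [/\ open (dom c), open (cod c),
      forall x, dom c x -> {for x, continuous (coord c)},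
      forall u, cod c u -> {for u, continuous (param c)} &
      forall x, dom c x -> param c (c x) = x].

End Charts.

(* The symplectic form is given by its component matrices in the charts of a
   smooth atlas: sform c u i j is omega(d/du^i, d/du^j) at the point of
   coordinates u in c. With the row-vector convention of 'J, entry (i, k) of the
   Jacobian of a change of coordinates u |-> v is dv^k/du^i. *)
Record symplectic_manifold (R : realType) (n : nat) (P : topologicalType) :=
  SymplecticManifold {
  atlas : set (chart R P (n + n)) ;
  sform : chart R P (n + n) -> 'rV[R]_(n + n) -> 'M[R]_(n + n) ;
  sm_hausdorff : hausdorff_space P ;
  sm_second_countable : @second_countable P ;
  atlas_chart : forall c, atlas c -> is_chart c ;
  atlas_cover : forall x, exists2 c, atlas c & dom c x ;
  atlas_compat : forall c c' j, atlas c -> atlas c' ->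
    smooth_on (c @` (dom c `&` dom c')) (fun u => c' (param c u) 0 j) ;
  sform_smooth : forall c i j, atlas c ->
    smooth_on (cod c) (fun u => sform c u i j) ;
  sform_skew : forall c u, atlas c -> cod c u ->
    (sform c u)^T = - sform c u ;
  sform_nondegenerate : forall c u, atlas c -> cod c u ->
    sform c u \in unitmx ;
  sform_closed : forall c u i j k, atlas c -> cod c u ->
    partial i (fun v => sform c v j k) u +
    partial j (fun v => sform c v k i) u +
    partial k (fun v => sform c v i j) u = 0 ;
  sform_change : forall c c' x, atlas c -> atlas c' -> dom c x -> dom c' x ->
    let J := 'J (coord c' \o param c) (c x) in
    sform c (c x) = J *m sform c' (c' x) *m J^T }.

Section Dynamics.
Context {R : realType} {n : nat} {P : topologicalType}.
Variable M : symplectic_manifold R n P.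
Implicit Types (c : chart R P (n + n)) (f g H : P -> R) (lambda : R -> P -> R).
Implicit Types (Phi xsol : R -> P -> P) (Gamma : set P).

Definition smooth_fun f : Prop :=
  forall c, atlas M c -> smooth_on (cod c) (f \o param c).

(* The first coordinate of z is the time. *)
Definition smooth_time_fun lambda : Prop :=
  forall c, atlas M c ->
    smooth_on [set z : 'rV[R]_(1 + (n + n)) | cod c (rsubmx z)]
              (fun z => lambda (lsubmx z 0 0) (param c (rsubmx z))).

Definition grad c f (x : P) : 'rV[R]_(n + n) :=
  \row_i partial i (f \o param c) (c x).

(* The Poisson bracket at x, computed in a chart c around x; its value does not
   depend on c. The sign is the one for which omega = sum_a dq^a /\ dp_a gives
   the canonical formula (poisson_canonical below). *)
Definition poisson c f g (x : P) : R :=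
  - (grad c f x *m invmx (sform M c (c x)) *m (grad c g x)^T) 0 0.

Lemma poisson_canonical c f g x :
  sform M c (c x) = block_mx 0 1%:M (- 1%:M) 0 ->
  poisson c f g x =
  \sum_(a < n)
    (partial (lshift n a) (f \o param c) (c x) *
     partial (rshift n a) (g \o param c) (c x) -
     partial (rshift n a) (f \o param c) (c x) *
     partial (lshift n a) (g \o param c) (c x)).
Proof.
move=> omegaE.
have invE : invmx (sform M c (c x)) = block_mx 0 (- 1%:M) 1%:M 0.
  have AB : sform M c (c x) *m block_mx 0 (- 1%:M) 1%:M 0 = 1%:M.
    rewrite omegaE mulmx_block !mul0mx !mulmx0 !mul1mx.
    by rewrite mulNmx mulmxN mul1mx opprK !addr0 !add0r -scalar_mx_block.
  by have [Au _] := mulmx1_unit AB; rewrite -[RHS](mulKmx Au) AB mulmx1.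
rewrite /poisson invE.
rewrite -[grad c f x]hsubmxK -[grad c g x]hsubmxK tr_row_mx.
rewrite mul_row_block !mulmx0 mulmx1 mulmxN mulmx1 add0r addr0 mul_row_col.
rewrite mulNmx !mxE opprD opprK addrC -sumrB.
by apply: eq_bigr => a _; rewrite !mxE.
Qed.

(* dx/dt = lambda {x, H} along the curve x, x being read in any chart. *)
Definition evolves lambda H (x : R -> P) : Prop :=
  continuous x /\
  forall c t i, atlas M c -> dom c (x t) ->
    is_derive t 1 (fun s => c (x s) 0 i)
      (lambda t (x t) * poisson c (fun y => c y 0 i) H (x t)).

Definition solution lambda H xsol : Prop :=
  forall x0, xsol 0 x0 = x0 /\ evolves lambda H (xsol ^~ x0).

Definition hamiltonian_flow H Phi : Prop := solution (fun _ _ => 1) H Phi.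

Definition oriented_integral (f : R -> R) (t : R) : R :=
  if 0 <= t then (\int[lebesgue_measure]_(s in `[0, t]) f s)%R
  else - (\int[lebesgue_measure]_(s in `[t, 0]) f s)%R.

Definition t_lambda lambda xsol (x0 : P) (tau : R) : R :=
  oriented_integral (fun s => lambda s (xsol s x0)) tau.

Definition admissible lambda xsol : Prop :=
  [/\ smooth_time_fun lambda,
      forall tau x, 0 < lambda tau x &
      forall x0, {homo t_lambda lambda xsol x0 : s t / s < t} /\
                 bijective (t_lambda lambda xsol x0)].

Definition trajectory Phi Gamma : Prop :=
  exists x0, Gamma = range (Phi ^~ x0).

Definition injective_on_trajectory xsol Gamma : Prop :=
  forall x0, Gamma x0 -> injective (xsol ^~ x0).

Definition happens_after xsol (X1 X2 x : P) : Prop :=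
  exists t1 t2, [/\ xsol t1 x = X1, xsol t2 x = X2 & t2 < t1].

Definition happens_before xsol (X1 X2 x : P) : Prop :=
  exists t1 t2, [/\ xsol t1 x = X1, xsol t2 x = X2 & t1 < t2].

(* TO is x |-> TO(X1, X2, x), only constrained on Gamma. *)
Definition is_temporal_order xsol Gamma (X1 X2 : P) (TO : P -> int) : Prop :=
  forall x, Gamma x ->
    [/\ happens_after xsol X1 X2 x -> TO x = 1,
        happens_before xsol X1 X2 x -> TO x = -1 &
        X1 = X2 -> TO x = 0].

End Dynamics.

(* Main.v *)
Require Import Defs.
From HB Require Import structures.
From mathcomp Require Import all_boot all_order all_algebra.
From mathcomp Require Import all_classical all_reals all_analysis.
From mathcomp Require Import lra.
Set Implicit Arguments.
Unset Strict Implicit.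
Unset Printing Implicit Defensive.
Import Order.TTheory GRing.Theory Num.Theory.
Import numFieldNormedType.Exports.
Local Open Scope classical_set_scope.
Local Open Scope ring_scope.

(* In a chart the Hamiltonian vector field X_H is C^1, hence locally Lipschitz,
   so two curves solving z' = a(t) X_H(z), with a continuous, and meeting at one
   time agree near that time; since P is Hausdorff and R connected they agree
   everywhere. With a = lambda(t, x(t)) this gives
   x(tau, x0) = Phi_{t_lambda(tau)}(x0), and with a = 1 the group law of Phi.
   Writing X_i = Phi_{r_i}(p0) and x = Phi_s(p0), the time tau_i is the solution
   of t_lambda(tau_i) = r_i - s, so that tau_1 and tau_2 compare like r_1 and
   r_2, independently of x: TO is the sign of r_1 - r_2. *)

(** * Locally Lipschitz real functions and their algebra *)

Section LipschitzAt.
Context {R : realType} {V : normedModType R}.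
Implicit Types (f g : V -> R) (u : V).

(** Both [v] and [w] vary near [u]: comparing two curves requires more than a bound on
    [f v - f u]. *)
Definition lipschitz_at u f := exists k, exists2 U, nbhs u U &
  forall v w, U v -> U w -> `|f v - f w| <= k * `|v - w|.

Lemma lipschitz_at_gt0 u f : lipschitz_at u f -> exists2 k, 0 < k &
  exists2 U, nbhs u U & forall v w, U v -> U w -> `|f v - f w| <= k * `|v - w|.
Proof.
move=> [k [U nU kP]]; exists (`|k| + 1); first by rewrite ltr_wpDl.
exists U => // v w Uv Uw; rewrite (le_trans (kP _ _ Uv Uw))// ler_wpM2r//.
by rewrite (le_trans (ler_norm _))// lerDl.
Qed.

Lemma lipschitz_at_continuous u f : lipschitz_at u f -> {for u, continuous f}.
Proof.
move=> /lipschitz_at_gt0[k k0 [U nU kP]]; apply/cvgrPdist_le => e e0.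
near=> v; rewrite (le_trans (kP _ _ (nbhs_singleton nU) _))//.
  by near: v.
rewrite mulrC -ler_pdivlMr//; near: v; apply: cvgr_dist_le => //.
by rewrite divr_gt0.
Unshelve. all: by end_near. Qed.

(** Allows replacing a function by a formula valid only near [u], for instance inside the codomain
    of a chart. *)
Lemma near_lipschitz_at u f g :
  (\forall v \near u, f v = g v) -> lipschitz_at u f -> lipschitz_at u g.
Proof.
move=> fg [k [U nU kP]]; exists k, (U `&` [set v | f v = g v]).
  exact: filterI.
by move=> v w [Uv /= <-] [Uw /= <-]; exact: kP.
Qed.

Lemma lipschitz_at_cst u a : lipschitz_at u (fun=> a).
Proof.
exists 0, setT; first exact: filterT.
by move=> v w _ _; rewrite subrr normr0 mul0r.
Qed.

Lemma lipschitz_atD u f g :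
  lipschitz_at u f -> lipschitz_at u g -> lipschitz_at u (fun v => f v + g v).
Proof.
move=> [k [U nU kP]] [l [W nW lP]]; exists (k + l), (U `&` W).
  exact: filterI.
move=> v w [Uv Wv] [Uw Ww].
by rewrite opprD addrACA mulrDl (le_trans (ler_normD _ _))// lerD ?kP ?lP.
Qed.

(** By continuity both factors are bounded near [u], and the increment of the product splits as
    [f v * (g v - g w) + g w * (f v - f w)]. *)
Lemma lipschitz_atM u f g :
  lipschitz_at u f -> lipschitz_at u g -> lipschitz_at u (fun v => f v * g v).
Proof.
move=> fl gl.
have cf := lipschitz_at_continuous fl; have cg := lipschitz_at_continuous gl.
have [k k0 [U nU kP]] := lipschitz_at_gt0 fl.
have [l l0 [W nW lP]] := lipschitz_at_gt0 gl.
exists ((`|f u| + 1) * l + (`|g u| + 1) * k),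
  (U `&` W `&` [set v | `|f v| < `|f u| + 1] `&` [set v | `|g v| < `|g u| + 1]).
  apply: filterI; last by apply: (cvgr_norm_lt _ cg); rewrite ltrDl.
  apply: filterI; last by apply: (cvgr_norm_lt _ cf); rewrite ltrDl.
  exact: filterI.
move=> v w [[[Uv Wv]/= /ltW fv] _] [[[Uw Ww] _]/= /ltW gw].
rewrite (_ : _ - _ = f v * (g v - g w) + g w * (f v - f w)); last first.
  by rewrite !mulrBr addrA [g w * f v]mulrC subrK [g w * f w]mulrC.
rewrite (le_trans (ler_normD _ _))// !normrM mulrDl -!mulrA.
by rewrite lerD// ler_pM// ?kP ?lP.
Qed.

(** Near [u] one has [|f| > e] with [e = |f u| / 2], so the increment [(f w - f v) / (f v * f w)] is
    at most [k / e ^ 2] times the distance. *)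
Lemma lipschitz_atV u f :
  f u != 0 -> lipschitz_at u f -> lipschitz_at u (fun v => (f v)^-1).
Proof.
move=> fu0 fl.
have cf := lipschitz_at_continuous fl.
have [k k0 [U nU kP]] := lipschitz_at_gt0 fl.
pose e := `|f u| / 2.
have e0 : 0 < e by rewrite divr_gt0// normr_gt0.
exists (e^-1 * e^-1 * k), (U `&` [set v | e < `|f v|]).
  apply: filterI => //; apply: (cvgr_norm_gt _ cf).
  by rewrite /e ltr_pdivrMr// ltr_pMr ?normr_gt0// ltr1n.
move=> v w [Uv /= fv] [Uw /= fw].
have fv0 : f v != 0 by rewrite -normr_gt0 (lt_trans e0).
have fw0 : f w != 0 by rewrite -normr_gt0 (lt_trans e0).
rewrite (_ : _ - _ = (f v)^-1 * (f w)^-1 * (f w - f v)); last first.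
  by rewrite mulrBr -mulrA mulVf// mulr1 mulrAC mulVf// mul1r.
rewrite !normrM !normfV -[leRHS]mulrA ler_pM//.
- by rewrite ler_pM ?invr_ge0// lef_pV2// ?posrE ?normr_gt0// ltW.
- by rewrite distrC kP.
Qed.

Lemma lipschitz_at_sum (I : Type) (r : seq I) (Q : pred I)
    (F : I -> V -> R) u :
  (forall i, Q i -> lipschitz_at u (F i)) ->
  lipschitz_at u (fun v => \sum_(i <- r | Q i) F i v).
Proof.
move=> Fl; elim: r => [|i r IHr].
  apply: near_lipschitz_at (lipschitz_at_cst _ 0).
  by apply: nearW => v; rewrite big_nil.
have [Qi|/negbTE Qi] := boolP (Q i).
  apply: near_lipschitz_at (lipschitz_atD (Fl i Qi) IHr).
  by apply: nearW => v; rewrite big_cons Qi.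
by apply: near_lipschitz_at IHr; apply: nearW => v; rewrite big_cons Qi.
Qed.

Lemma lipschitz_at_prod (I : Type) (r : seq I) (Q : pred I)
    (F : I -> V -> R) u :
  (forall i, Q i -> lipschitz_at u (F i)) ->
  lipschitz_at u (fun v => \prod_(i <- r | Q i) F i v).
Proof.
move=> Fl; elim: r => [|i r IHr].
  apply: near_lipschitz_at (lipschitz_at_cst _ 1).
  by apply: nearW => v; rewrite big_nil.
have [Qi|/negbTE Qi] := boolP (Q i).
  apply: near_lipschitz_at (lipschitz_atM (Fl i Qi) IHr).
  by apply: nearW => v; rewrite big_cons Qi.
by apply: near_lipschitz_at IHr; apply: nearW => v; rewrite big_cons Qi.
Qed.

Lemma lipschitz_at_det m (S : V -> 'M[R]_m) u :
  (forall i j, lipschitz_at u (fun v => S v i j)) ->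
  lipschitz_at u (fun v => \det (S v)).
Proof.
move=> Sl; apply: lipschitz_at_sum => s _; apply: lipschitz_atM.
  exact: lipschitz_at_cst.
by apply: lipschitz_at_prod => i _.
Qed.

(** Cramer's rule: near [u] the entries of the inverse are cofactors divided by a nonzero
    determinant. *)
Lemma lipschitz_at_invmx m (S : V -> 'M[R]_m) u :
  (\forall v \near u, S v \in unitmx) ->
  (forall i j, lipschitz_at u (fun v => S v i j)) ->
  forall i j, lipschitz_at u (fun v => invmx (S v) i j).
Proof.
move=> Su Sl i j.
apply: (@near_lipschitz_at _ (fun v => (\det (S v))^-1 * cofactor (S v) j i)).
  by near=> v; rewrite /invmx (near Su v)// !mxE.
apply: lipschitz_atM.
  apply: lipschitz_atV; last exact: lipschitz_at_det.
  by have := nbhs_singleton Su; rewrite unitmxE unitfE.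
apply: lipschitz_atM; first exact: lipschitz_at_cst.
apply: lipschitz_at_det => a b.
by under eq_fun do rewrite !mxE.
Unshelve. all: by end_near. Qed.

End LipschitzAt.

(** * Mean value estimates and local uniqueness for differential equations in coordinates *)

Section RowVectors.
Context {R : realType} {m : nat}.
Implicit Types (u v w : 'rV[R]_m) (f : 'rV[R]_m -> R).

Lemma normr_coord_le v i : `|v 0 i| <= `|v|.
Proof.
by rewrite [leRHS]/Num.Def.normr/= mx_normrE (le_bigmax _ _ (ord0, i)).
Qed.

Lemma normr_row_le v e : 0 <= e -> (forall i, `|v 0 i| <= e) -> `|v| <= e.
Proof.
move=> e0 ve; rewrite [leLHS]/Num.Def.normr/= mx_normrE.
rewrite bigmax_le//= => -[i j] _.
by rewrite /= ord1.
Qed.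

(** Mean value inequality. The endpoints may come in either order, since increments of coordinates
    and of time have either sign. *)
Lemma le_dist_derive (g dg : R -> R) (a b K : R) :
  (forall t, t \in `[Num.min a b, Num.max a b] ->
    is_derive t 1 g (dg t) /\ `|dg t| <= K) ->
  `|g b - g a| <= K * `|b - a|.
Proof.
wlog ab : a b / a <= b.
  move=> H gP; have [ab|/ltW ba] := leP a b; first exact: H.
  by rewrite distrC [`|b - a|]distrC; apply: H => //; rewrite minC maxC.
rewrite min_l// max_r// => gP.
have [t|t tab|c cab ->] := @MVT_segment _ g dg a b ab.
- by move=> /subset_itv_oo_cc /gP[].
- apply: derivable_within_continuous => {}t /gP[dgt _]; exact: ex_derive.
- by rewrite normrM ler_wpM2r//; have [] := gP _ cab.
Qed.

Lemma is_derive_line f u i t :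
  derivable f (u + t *: delta_mx 0 i) (delta_mx 0 i) ->
  is_derive t 1 (fun s => f (u + s *: delta_mx 0 i))
    (partial i f (u + t *: delta_mx 0 i)).
Proof.
have E h : h *: (delta_mx 0 i : 'rV[R]_m) + (u + t *: delta_mx 0 i) =
    u + (h *: (1 : R) + t) *: delta_mx 0 i.
  by rewrite addrCA scalerDl [_ *: 1]mulr1.
move=> df; split.
  by move: df; rewrite /derivable; under eq_fun do rewrite /= E.
by rewrite /partial /derive; under [in RHS]eq_fun do rewrite /= E.
Qed.

(** By continuity [K] bounds every partial derivative on a ball around [u]; going from [v] to [w]
    takes [m] moves parallel to the axes, each changing [f] by at most [K * |v - w|]. *)
Lemma is_C1_lipschitz_at (U : set 'rV[R]_m) f u :
  open U -> is_Ck 1 U f -> U u -> lipschitz_at u f.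
Proof.
move=> oU [_ fP] Uu.
pose K := \sum_i (`|partial i f u| + 1).
have K0 : 0 <= K by apply: sumr_ge0 => i _; exact: addr_ge0.
have : \forall v \near u, U v /\ forall i, `|partial i f v| <= K.
  near=> v; split; first by near: v; exact: open_nbhs_nbhs.
  near: v; apply: filter_forall => i.
  have [_ [cf _]] := fP i.
  near=> v; apply: (@le_trans _ _ (`|partial i f u| + 1)).
    apply: ltW; near: v; apply: (cvgr_norm_lt _ (cf _ Uu)).
    by rewrite ltrDl.
  by rewrite /K (bigD1 i)//= lerDl sumr_ge0// => j _; exact: addr_ge0.
move=> /nbhs_ballP[r /= r0 rP].
exists (m%:R * K), (ball u r); first exact: nbhsx_ballx.
move=> v w [_ uv] [_ uw].
(* hybrid k travels from v to w one coordinate at a time, inside the box. *)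
pose hybrid k : 'rV[R]_m := \row_j if (j < k)%N then w 0 j else v 0 j.
have -> : v = hybrid 0 by apply/rowP => j; rewrite mxE.
have -> : w = hybrid m by apply/rowP => j; rewrite mxE ltn_ord.
rewrite distrC -(telescope_sumr (f \o hybrid))//=.
rewrite big_mkord (le_trans (ler_norm_sum _ _ _))//.
rewrite -mulrA mulr_natl -[X in _ *+ X]card_ord -sumr_const ler_sum// => k _.
have -> : hybrid k.+1 = hybrid k + (w 0 k - v 0 k) *: delta_mx 0 k.
  apply/rowP => j; rewrite !mxE ltnS eqxx/= -val_eqE /=.
  by case: ltngtP => [||/val_inj ->] /=; rewrite ?mulr0 ?addr0 ?mulr1 ?subrKC.
(* Balls of the sup norm are boxes, so a point whose coordinates lie between those of [v] and [w]
   stays in the ball. *)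
have kball t : t \in `[Num.min 0 (w 0 k - v 0 k), Num.max 0 (w 0 k - v 0 k)] ->
    ball u r (hybrid k + t *: delta_mx 0 k).
  rewrite in_itv/= => tI; split=> // i j; rewrite ord1 !mxE eqxx/= -val_eqE /=.
  move: (uv 0 j) (uw 0 j); rewrite /ball/= !ltr_distl.
  case: ltngtP => [||/val_inj jk] /=; rewrite ?mulr0 ?addr0 ?mulr1//.
  by move: tI; rewrite jk; case: (leP 0 (w 0 k - v 0 k)) => ? ? ? ?; lra.
rewrite -[X in f _ - f X]addr0 -[X in f _ - f (_ + X)](scale0r (delta_mx 0 k)).
apply: (le_trans (@le_dist_derive (fun s => f (hybrid k + s *: delta_mx 0 k))
  (fun s => partial k f (hybrid k + s *: delta_mx 0 k)) 0 (w 0 k - v 0 k) K _)).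
  move=> t /kball/rP[Ut ft]; split; last exact: ft.
  by apply: is_derive_line; have [dU _] := fP k; exact: dU.
rewrite subr0 ler_wpM2l// distrC (le_trans _ (normr_coord_le _ k))//.
by rewrite !mxE ltn_ord.
Unshelve. all: by end_near. Qed.

(** Let [N] be the maximum of [|x - z|] on a short interval around [t0]. Integrating the Lipschitz
    bound from [t0], in the form of the mean value inequality, gives [N <= N / 2], hence [N = 0]. *)
Lemma ode_unique_near (F : 'I_m -> 'rV[R]_m -> R) (a : R -> R)
    (x z : R -> 'rV[R]_m) t0 :
  (forall i, lipschitz_at (x t0) (F i)) -> {for t0, continuous a} ->
  (\forall t \near t0, forall i,
    is_derive (t : R) 1 (fun s => x s 0 i) (a t * F i (x t))) ->
  (\forall t \near t0, forall i,
    is_derive (t : R) 1 (fun s => z s 0 i) (a t * F i (z t))) ->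
  x t0 = z t0 -> \forall t \near t0, x t = z t.
Proof.
move=> Fl ca dx dz xz0.
have cts (y : R -> 'rV[R]_m) t :
    (forall i, is_derive (t : R) 1 (fun s => y s 0 i) (a t * F i (y t))) ->
    {for t, continuous y}.
  move=> yt; apply/differentiable_continuous/derivable1_diffP.
  apply/derivable_mxP => i j.
  by rewrite ord1; apply: ex_derive.
have [K [K0 [U nU KP]]] : exists K, 0 < K /\ exists2 U, nbhs (x t0) U &
    forall i v w, U v -> U w -> `|F i v - F i w| <= K * `|v - w|.
  have /choice[k kP] i : exists k, 0 < k /\ exists2 U, nbhs (x t0) U &
      forall v w, U v -> U w -> `|F i v - F i w| <= k * `|v - w|.
    by have [k k0 kP] := lipschitz_at_gt0 (Fl i); exists k.
  have /choice[U UP] i : exists U, nbhs (x t0) U /\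
      forall v w, U v -> U w -> `|F i v - F i w| <= k i * `|v - w|.
    by have [_ [U nU UP]] := kP i; exists U.
  (* One constant for all components; the summand 1 keeps it positive even if [m = 0]. *)
  exists (1 + \sum_i k i); split.
    by rewrite ltr_pwDl// sumr_ge0// => i _; have [/ltW] := kP i.
  exists [set v | forall i, U i v].
    suff: \forall v \near x t0, forall i, U i v by [].
    exact: (@filter_forall _ _ U _ _ (fun i => (UP i).1)).
  move=> i v w Uv Uw; have [_ UiP] := UP i.
  rewrite (le_trans (UiP _ _ (Uv i) (Uw i)))// ler_wpM2r//.
  rewrite (bigD1 i)//= addrCA lerDl addr_ge0// sumr_ge0// => j _.
  by have [/ltW] := kP j.
pose A := `|a t0| + 1.
have A0 : 0 < A by rewrite ltr_wpDl.
have cx := cts x _ (nbhs_singleton dx).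
have cz := cts z _ (nbhs_singleton dz).
have : \forall t \near t0, [/\ U (x t), U (z t), `|a t| <= A,
    forall i, is_derive (t : R) 1 (fun s => x s 0 i) (a t * F i (x t)) &
    forall i, is_derive (t : R) 1 (fun s => z s 0 i) (a t * F i (z t))].
  near=> t; split.
  - by near: t; exact: cx.
  - by near: t; apply: cz; rewrite -xz0.
  - apply: ltW; near: t; apply: (cvgr_norm_lt _ ca); first by rewrite ltrDl.
  - by near: t.
  - by near: t.
move=> /nbhs_ballP[r /= r0 rP].
(* [r / 2] keeps the closed interval inside the ball of radius [r]; the other bound gives
   [A * K * d <= 1 / 2]. *)
pose d := Num.min (r / 2) (A * K * 2)^-1.
have d0 : 0 < d by rewrite lt_min divr_gt0// invr_gt0 !mulr_gt0.
have dr : d < r.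
  by rewrite gt_min; apply/orP; left; rewrite ltr_pdivrMr// ltr_pMr// ltr1n.
have dAK : A * K * d <= 2^-1.
  rewrite -ler_pdivlMl ?mulr_gt0// -invfM ?(mulrC 2) ge_min lexx orbT//.
have inr t : t \in `[t0 - d, t0 + d] -> ball t0 r t.
  rewrite in_itv/= => tI; rewrite /ball/= distrC (le_lt_trans _ dr)//.
  by rewrite ler_distl.
have [] := @EVT_max R (fun t => `|x t - z t|) (t0 - d) (t0 + d).
- by rewrite lerD2l ge0_cp// ltW.
- apply: continuous_in_subspaceT => t /[!inE]/= /inr/rP[_ _ _ xt zt].
  apply: cvg_norm; apply: cvgB; exact: cts.
move=> s sI sP; set N := `|x s - z s| in sP.
suff N0 : N <= 0.
  near=> t; apply/eqP; rewrite -subr_eq0 -normr_le0 (le_trans (sP t _))//.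
  rewrite in_itv/= -ler_distl distrC; near: t; apply: cvgr_dist_le => //.
have : N <= 2^-1 * N.
  apply: normr_row_le; first by rewrite mulr_ge0 ?normr_ge0.
  move=> i; rewrite !mxE.
  have := @le_dist_derive (fun t => x t 0 i - z t 0 i)
    (fun t => a t * F i (x t) - a t * F i (z t)) t0 s (A * (K * N)) _.
  rewrite xz0 subrr subr0 => H; apply: (le_trans (H _)).
    move=> t tI.
    have tI' : t \in `[t0 - d, t0 + d].
      by move: tI sI; rewrite !in_itv/=; case: (leP t0 s) => ? ? ?; lra.
    have [Ux Uz aA xt zt] := rP _ (inr _ tI').
    split; first exact: is_deriveB.
    rewrite -mulrBr normrM ler_pM// (le_trans (KP _ _ _ Ux Uz))//.
    by rewrite ler_wpM2l ?sP// ltW.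
  rewrite mulrA mulrAC ler_wpM2r ?normr_ge0// (le_trans _ dAK)// ler_wpM2l//.
    by rewrite mulr_ge0// ltW.
  by move: sI; rewrite in_itv/= ler_distl.
rewrite -subr_le0 -{1}[N]mul1r -mulrBl pmulr_rle0//.
by rewrite subr_gt0 invf_lt1// ltr1n.
Unshelve. all: by end_near. Qed.

End RowVectors.

(** * The oriented integral as a primitive *)

Section OrientedIntegral.
Context {R : realType}.
Implicit Types f : R -> R.

Lemma continuous_integrable_segment f (a b : R) : continuous f ->
  (@lebesgue_measure R).-integrable `[a, b] (EFin \o f).
Proof.
move=> cf; apply: continuous_compact_integrable; first exact: segment_compact.
exact: continuous_subspaceT.
Qed.

Lemma continuous_integrable_itvoc f (a b : R) : continuous f ->
  (@lebesgue_measure R).-integrable `]a, b] (EFin \o f).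
Proof.
move=> cf; apply: integrableS (continuous_integrable_segment a b cf) => //.
exact: subset_itv_oc_cc.
Qed.

Lemma oriented_integral0 f : oriented_integral f 0 = 0.
Proof. by rewrite /oriented_integral lexx set_itv1 Rintegral_set1. Qed.

(** A base point to the left of both 0 and [t] removes the case distinction on the sign of [t]. *)
Lemma oriented_integralE f (b t : R) : continuous f -> b <= 0 -> b <= t ->
  oriented_integral f t =
    (\int[lebesgue_measure]_(s in `[b, t]) f s)%R -
    (\int[lebesgue_measure]_(s in `[b, 0]) f s)%R.
Proof.
move=> cf b0 bt; rewrite /oriented_integral; case: leP => [t0|/ltW t0].
  rewrite Rintegral_itvB ?bnd_simp//; last exact: continuous_integrable_segment.
  by rewrite Rintegral_itv_obnd_cbnd//; exact: continuous_integrable_itvoc.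
rewrite -[RHS]opprB Rintegral_itvB ?bnd_simp//; last first.
  exact: continuous_integrable_segment.
by rewrite Rintegral_itv_obnd_cbnd//; exact: continuous_integrable_itvoc.
Qed.

Lemma is_derive_oriented_integral f (t : R) : continuous f ->
  is_derive t 1 (oriented_integral f) (f t).
Proof.
(* Being strictly below 0 and [t], the same [b] serves for all [y] near [t], where the oriented
   integral is [G] up to a constant. *)
move=> cf; pose b := Num.min 0 t - 1.
have b0 : b < 0 by rewrite /b; case: (ltP 0 t); lra.
have bt : b < t by rewrite /b; case: (ltP 0 t); lra.
pose G y := (\int[lebesgue_measure]_(s in `[b, y]) f s)%R.
apply: (@near_eq_is_derive _ _ _ (G - cst (G 0))).
  near=> y; rewrite (@oriented_integralE _ b)// ?ltW//; near: y.
  exact: lt_nbhsr.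
rewrite -[f t]subr0; apply: is_deriveB.
have [||Gt] := @continuous_FTC1_closed R f b t (t + 1) _ _ bt (cf t).
- by rewrite ltrDl.
- exact: continuous_integrable_segment.
- by rewrite derive1E => GtE; split.
Unshelve. all: by end_near. Qed.

End OrientedIntegral.

(** * Integral curves of the Hamiltonian vector field: uniqueness, group law, reparametrization *)

Section IntegralCurves.
Context {R : realType} {n : nat} {P : topologicalType}.
Context (M : symplectic_manifold R n P).
Implicit Types (c : chart R P (n + n)) (f g : P -> R) (a T : R -> R).
Implicit Types (x y z : R -> P).

Lemma paramK c p : is_chart c -> dom c p -> param c (c p) = p.
Proof. by move=> [_ _ _ _]; exact. Qed.

Lemma coordK c u : is_chart c -> cod c u -> c (param c u) = u.
Proof. by move=> [_ _ _ _ cK] [x xc <-]; rewrite cK. Qed.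

Lemma near_cod c u : is_chart c -> cod c u -> \forall v \near u, cod c v.
Proof. by move=> [_ oc _ _ _] cu; exact: open_nbhs_nbhs. Qed.

Lemma near_dom c x t : is_chart c -> {for t, continuous x} -> dom c (x t) ->
  \forall s \near t, dom c (x s).
Proof. by move=> [od _ _ _ _] cx dx; apply: cx; exact: open_nbhs_nbhs. Qed.

Lemma continuous_coord_comp c x t : is_chart c -> {for t, continuous x} ->
  dom c (x t) -> {for t, continuous (c \o x)}.
Proof.
by move=> [_ _ cc _ _] cx dx; apply: continuous_comp => //; exact: cc.
Qed.

Lemma lipschitz_at_grad c f u i : atlas M c -> is_Ck 2 (cod c) (f \o param c) ->
  cod c u -> lipschitz_at u (fun v => grad c f (param c v) 0 i).
Proof.
move=> /(@atlas_chart _ _ _ M) cP [_ /(_ i)[_ fP]] cu.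
apply: near_lipschitz_at (is_C1_lipschitz_at _ fP cu); last by case: cP.
by near=> v; rewrite mxE coordK//; near: v; exact: near_cod.
Unshelve. all: by end_near. Qed.

(** With [f] a coordinate and [g] the Hamiltonian constraint, the bracket is a component of X_H, so
    this supplies the Lipschitz hypothesis of [ode_unique_near]. *)
Lemma lipschitz_at_poisson c f g u : atlas M c ->
  is_Ck 2 (cod c) (f \o param c) -> is_Ck 2 (cod c) (g \o param c) ->
  cod c u -> lipschitz_at u (poisson M c f g \o param c).
Proof.
move=> ac f2 g2 cu; have cP := atlas_chart ac.
pose S v := invmx (sform M c v).
apply: (@near_lipschitz_at _ _ _ (fun v => -1 * \sum_k (\sum_j
    grad c f (param c v) 0 j * S v j k) * grad c g (param c v) 0 k)).
  near=> v; rewrite mulN1r /= /poisson; congr -%R; rewrite mxE.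
  apply: eq_bigr => k _; rewrite !mxE; congr (_ * _).
    by apply: eq_bigr => j _; rewrite coordK//; near: v; exact: near_cod.
apply: lipschitz_atM; first exact: lipschitz_at_cst.
apply: lipschitz_at_sum => k _.
apply: lipschitz_atM; last exact: lipschitz_at_grad.
apply: lipschitz_at_sum => j _.
apply: lipschitz_atM; first exact: lipschitz_at_grad.
apply: lipschitz_at_invmx => [|i l].
  by near=> v; apply: sform_nondegenerate => //; near: v; exact: near_cod.
apply: (@is_C1_lipschitz_at _ _ (cod c)) => //; first by case: cP.
exact: (sform_smooth _ _ ac).
Unshelve. all: by end_near. Qed.

(** This is the compatibility of the chart [c] with itself. *)
Lemma is_Ck_coord c i k : atlas M c ->
  is_Ck k (cod c) ((fun p : P => c p 0 i) \o param c).
Proof.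
by move=> ac; have := @atlas_compat _ _ _ M c c i ac ac k; rewrite setIid.
Qed.

Context (H : P -> R) (H_smooth : smooth_fun M H).

(** The coefficient depends on time only: a position-dependent [lambda] is first evaluated along a
    given curve. *)
Lemma evolves_unique a x z t0 : continuous a ->
  evolves M (fun t _ => a t) H x -> evolves M (fun t _ => a t) H z ->
  x t0 = z t0 -> x = z.
Proof.
move=> ca [cx dx] [cz dz] xz0.
pose A := [set t | x t = z t].
suff AT : A = setT by apply/funext => t; have : A t by rewrite AT.
(* A nonempty open and closed subset of the connected line is the whole line. *)
apply: (connected_intervalP setT).2.
- by [].
- by exists t0.
(* Open: in a chart around the common point, with [F] the components of X_H, local uniqueness holds
   in coordinates, and [param] carries the equality back to [P]. *)
- exists A; last by rewrite setTI.
  rewrite openE => t At; rewrite /interior.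
  have [c ac dc] := atlas_cover M (x t); have cP := atlas_chart ac.
  pose F i u := poisson M c (fun p => c p 0 i) H (param c u).
  have ode y : evolves M (fun t _ => a t) H y -> dom c (y t) ->
      \forall s \near t, forall i,
        is_derive (s : R) 1 (fun r => c (y r) 0 i) (a s * F i (c (y s))).
    move=> [cy dy] dyt; near=> s => i.
    have dys : dom c (y s) by near: s; apply: near_dom => //; exact: cy.
    by rewrite /F paramK//; exact: dy.
  have := @ode_unique_near R (n + n) F a (c \o x) (c \o z) t.
  move=> /(_ _ (ca t) (ode _ (conj cx dx) dc) (ode _ (conj cz dz) _)).
  have dcz : dom c (z t) by rewrite -At.
  move=> /(_ _ dcz) xz.
  near=> s.
  have dxs : dom c (x s) by near: s; apply: near_dom => //; exact: cx.
  have dzs : dom c (z s) by near: s; apply: near_dom => //; exact: cz.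
  rewrite /A/= -(paramK cP dxs) -(paramK cP dzs); congr param.
  near: s; apply: xz; last by rewrite /= At.
  move=> i; apply: lipschitz_at_poisson => //; first exact: is_Ck_coord.
    exact: H_smooth.
  by exists (x t).
(* Closed: distinct values have disjoint open neighbourhoods, which contain the two curves at nearby
   times. *)
- exists A; last by rewrite setTI.
  rewrite -openC openE => t /eqP xzt; rewrite /interior.
  have := sm_hausdorff M; rewrite open_hausdorff => /(_ _ _ xzt).
  move=> [[B C] /= [/[!inE] Bx Cz] [oB oC BC]].
  near=> s => As; have : (B `&` C) (x s).
    split; first by near: s; apply: cx; exact: open_nbhs_nbhs.
    by rewrite As; near: s; apply: cz; exact: open_nbhs_nbhs.
  by rewrite BC.
Unshelve. all: by end_near. Qed.

(** Chain rule. A translation [T] yields the group law of the flow; the integral of [lambda] along a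
    solution yields the reparametrization formula. *)
Lemma evolves_comp y T a :
  evolves M (fun _ _ => 1) H y -> (forall t : R, is_derive t 1 T (a t)) ->
  evolves M (fun t _ => a t) H (y \o T).
Proof.
move=> [cy dy] dT; split.
  move=> t; apply: continuous_comp; last exact: cy.
  by apply/differentiable_continuous/derivable1_diffP; exact: ex_derive.
move=> c t i ac dc; rewrite mulrC -[X in X * _]mul1r.
apply: (is_derive1_comp _ _ (f := fun s => c (y s) 0 i)); exact: dy.
Qed.

(** As functions of [t], both sides solve the equation with coefficient 1 and agree at [t = 0]. *)
Lemma flowD (Phi : R -> P -> P) s t p : hamiltonian_flow M H Phi ->
  Phi (t + s) p = Phi t (Phi s p).
Proof.
move=> flow; have [_ ep] := flow p; have [eq0 eq] := flow (Phi s p).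
suff: Phi^~ p \o (fun t => t + s) = Phi^~ (Phi s p).
  by move=> /(congr1 (@^~ t)).
apply: (@evolves_unique (fun=> 1) _ _ 0) => //=.
- exact: cst_continuous.
- apply: evolves_comp => // r; rewrite -[X in is_derive _ _ _ X]addr0.
  exact: is_deriveD.
- by rewrite add0r eq0.
Qed.

(** In a chart the function is [lambda] in coordinates composed with the curve [(t, c (x t))]. It
    serves as the coefficient [a] in [evolves_unique]. *)
Lemma continuous_time_fun (lambda : R -> P -> R) x :
  smooth_time_fun M lambda -> continuous x ->
  continuous (fun t => lambda t (x t)).
Proof.
move=> lambdaP cx t.
have [c ac dc] := atlas_cover M (x t); have cP := atlas_chart ac.
have [/= ct _] := lambdaP c ac 0.
pose g s : 'rV[R]_(1 + (n + n)) := row_mx (const_mx s) (c (x s)).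
have cg : {for t, continuous g}.
  apply/cvg_ballP => e e0; near=> s.
  have ts : ball t e s by near: s; apply/nbhs_ballP; exists e.
  have xts : ball (c (x t) : 'rV[R]_(n + n)) e (c (x s)).
    near: s; apply: (continuous_coord_comp cP (cx t) dc).
    exact: nbhsx_ballx.
  split=> // i j; rewrite ord1 !mxE.
  case: fintype.split => k; first by rewrite !mxE.
  by move: xts => -[_ /(_ 0 k)].
pose f (u : 'rV[R]_(1 + (n + n))) := lambda (lsubmx u 0 0) (param c (rsubmx u)).
have cfg : {for t, continuous (f \o g)}.
  by apply: continuous_comp => //; apply: ct; rewrite /= row_mxKr; exists (x t).
(* [param] inverts [c] on [dom c], so this identity holds as long as the curve stays in the chart,
   hence near [t]. *)
have fgE s : dom c (x s) -> (f \o g) s = lambda s (x s).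
  by move=> ds; rewrite /= /f row_mxKl row_mxKr mxE paramK.
rewrite /continuous_at -(fgE t dc); apply: cvg_trans cfg; apply: near_eq_cvg.
by near=> s; rewrite fgE//; near: s; apply: near_dom => //; exact: cx.
Unshelve. all: by end_near. Qed.

(* Both curves solve the non-autonomous equation z' = a(t) X_H(z) with
   a(t) = lambda(t, x(t)), whose right-hand side is locally Lipschitz in z. *)
Lemma solution_reparam (Phi : R -> P -> P) (lambda : R -> P -> R)
    (xsol : R -> P -> P) t p :
  hamiltonian_flow M H Phi -> solution M lambda H xsol ->
  smooth_time_fun M lambda -> xsol t p = Phi (t_lambda lambda xsol p t) p.
Proof.
move=> flow sol lambdaP; have [P0 eP] := flow p; have [x0 ex] := sol p.
pose a s := lambda s (xsol s p).
have ca : continuous a by apply: continuous_time_fun => //; case: ex.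
suff: xsol^~ p = Phi^~ p \o oriented_integral a by move=> /(congr1 (@^~ t)).
apply: (evolves_unique (t0 := 0) ca); first by [].
  by apply: evolves_comp => // s; exact: is_derive_oriented_integral.
by rewrite /= oriented_integral0 x0 P0.
Qed.

End IntegralCurves.

(** * Existence and constancy of the temporal order function *)

Theorem theorem2 (R : realType) (n : nat) (P : topologicalType)
    (M : symplectic_manifold R n P)
    (H : P -> R) (H_smooth : smooth_fun M H)
    (Phi : R -> P -> P) (Phi_flow : hamiltonian_flow M H Phi)
    (lambda : R -> P -> R) (xsol : R -> P -> P)
    (xsol_solution : solution M lambda H xsol)
    (lambda_admissible : admissible M lambda xsol)
    (Gamma : set P) (Gamma_trajectory : trajectory Phi Gamma)
    (Gamma_injective : injective_on_trajectory xsol Gamma)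
    (X1 X2 : P) (X1_Gamma : Gamma X1) (X2_Gamma : Gamma X2) :
  (forall x, Gamma x -> exists! tau1, xsol tau1 x = X1) /\
  (forall x, Gamma x -> exists! tau2, xsol tau2 x = X2) /\
  exists TO : P -> int,
    is_temporal_order xsol Gamma X1 X2 TO /\
    (forall x y, Gamma x -> Gamma y -> TO x = TO y).
Proof.
have [lambdaP _ tP] := lambda_admissible.
have xsolE t p := solution_reparam H_smooth t p Phi_flow xsol_solution lambdaP.
have [p0 GammaE] := Gamma_trajectory.
(* If [x] and [X] have flow parameters [s] and [r] from [p0], the flow goes from [x] to [X] in time
   [r - s], a value taken by the bijection [t_lambda]; uniqueness is the injectivity of the
   dynamics. *)
have reach x X : Gamma x -> Gamma X -> exists! tau, xsol tau x = X.
  move=> Gx; have := Gx; rewrite GammaE => -[s _ sx] [r _ <-].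
  have [tmono [tinv _ tinvK]] := tP x.
  exists (tinv (r - s)); split.
    by rewrite xsolE tinvK -sx -(flowD H_smooth)// subrK.
  move=> tau' E; apply: (Gamma_injective _ Gx); rewrite E.
  by rewrite xsolE tinvK -sx -(flowD H_smooth)// subrK.
split; first by move=> x Gx; exact: reach.
split; first by move=> x Gx; exact: reach.
have Gp0 : Gamma p0 by rewrite GammaE; exists 0 => //; have [] := Phi_flow p0.
(* Surjectivity of [t_lambda] at [p0] transfers injectivity from [xsol] to the flow. *)
have Phi_inj : injective (Phi^~ p0).
  have [_ [tinv tK tinvK]] := tP p0.
  move=> s r E; rewrite -[s]tinvK -[r]tinvK; congr t_lambda.
  by apply: (Gamma_injective _ Gp0); rewrite !xsolE !tinvK.
have [r1 _ r1X] : range (Phi^~ p0) X1 by rewrite -GammaE.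
have [r2 _ r2X] : range (Phi^~ p0) X2 by rewrite -GammaE.
have time x s t X r : Phi s p0 = x -> Phi r p0 = X -> xsol t x = X ->
    t_lambda lambda xsol x t = r - s.
  move=> sx rX; rewrite xsolE -rX -{2}sx -(flowD H_smooth)// => /Phi_inj <-.
  by rewrite addrK.
(* The sign does not involve [x], so constancy is immediate and only the three cases remain. *)
exists (fun=> sgz (r1 - r2)); split=> // x; rewrite {1}GammaE => -[s _ sx].
have [tmono _] := tP x.
split=> [[t1 [t2 [t1X t2X lt21]]]|[t1 [t2 [t1X t2X lt12]]]|X12].
(* Subtracting [s] turns [r1] and [r2] into the values of [t_lambda] at [t1] and [t2], which are
   ordered like [t1] and [t2]. *)
- rewrite gtr0_sgz// subr_gt0 -(ltrD2r (- s)) -(time _ _ _ _ _ sx r1X t1X).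
  by rewrite -(time _ _ _ _ _ sx r2X t2X); exact: tmono.
- rewrite ltr0_sgz// subr_lt0 -(ltrD2r (- s)) -(time _ _ _ _ _ sx r1X t1X).
  by rewrite -(time _ _ _ _ _ sx r2X t2X); exact: tmono.
- suff -> : r1 = r2 by rewrite subrr sgz0.
  by apply: Phi_inj; rewrite r1X r2X.
Qed.
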